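(* Let $X$ be a non-reflexive real Banach space. Then the operator $$T:X\times X^*\to X^{*}\times X^{**},\qquad T(x,x^* )=(-x^*,x)$$ (where $x\in X$ is regarded as an element of $X^{**}$ via the canonical injection) is a linear isometry which, regarded as an operator from the Banach space $X\times X^*$ to its dual $X^*\times X^{**}$, is maximal monotone and is not of type (D). Moreover, $T$ has infinitely many maximal monotone extensions to $X^{**}\times X^{***}\rightrightarrows X^*\times X^{**}$; that is, there are infinitely many distinct maximal monotone operators $B:X^{**}\times X^{***}\rightrightarrows X^*\times X^{**}$ whose graph contains the graph of $T$.
   Context: Banach spaces are real. For a Banach space $Z$ with topological dual $Z^*$, write $\langle z,z^*\rangle=\langle z^*,z\rangle=z^*(z)$. The bidual is $Z^{**}=(Z^* )^*$, and $Z$ is identified with its image under the canonical isometric injection $J:Z\to Z^{**}$, $\langle z^*,J(z)\rangle=\langle z^*,z\rangle$. $Z$ is non-reflexive if $J$ is not onto. A point-to-set operator $S:A\rightrightarrows B$ is determined by its graph $\operatorname{gra}(S)\subset A\times B$, with $S(a)=\{b : (a,b)\in\operatorname{gra}(S)\}$. A map $F:A\to B$ is identified with the point-to-set operator having the same graph. An operator $S:Z\rightrightarrows Z^*$ is monotone if $\langle z-w,z^*-w^*\rangle\ge 0$ for all $(z,z^* ),(w,w^* )\in\operatorname{gra}(S)$. An operator $S:Z^{**}\rightrightarrows Z^*$ is monotone if $\langle z^{**}-w^{**},z^*-w^*\rangle\ge 0$ for all $(z^{**},z^* ),(w^{**},w^* )\in\operatorname{gra}(S)$. In either case $S$ is maximal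 monotone if it is monotone and its graph is maximal, with respect to inclusion, among the graphs of monotone operators between the same two spaces. For $S:Z\rightrightarrows Z^*$, the operator $\overline S:Z^{**}\rightrightarrows Z^*$ is the one whose graph is the set of all limits, in the (weak-$*$)$\times$(norm) topology of $Z^{**}\times Z^*$, of bounded nets of elements of $\operatorname{gra}(S)$ (with $Z\subset Z^{**}$). A maximal monotone operator $S:Z\rightrightarrows Z^*$ is of type (D) if every $(z^{**},z^* )\in Z^{**}\times Z^*$ satisfying $\langle z^*-y^*,z^{**}-y\rangle\ge 0$ for all $(y,y^* )\in\operatorname{gra}(S)$ belongs to $\operatorname{gra}(\overline S)$. These notions are applied to $Z=X\times X^*$, with $Z^*=X^*\times X^{**}$ and $Z^{**}=X^{**}\times X^{***}$ under the pairings $\langle (x,x^* ),(y^*,y^{**})\rangle=\langle x,y^*\rangle+\langle x^*,y^{**}\rangle$ and $\langle (x^{**},x^{***}),(y^*,y^{**})\rangle=\langle x^{**},y^*\rangle+\langle x^{***},y^{**}\rangle$. The inclusion $Z\subset Z^{**}$ is then the product of the canonical inclusions $X\subset X^{**}$ and $X^*\subset X^{***}$. Product spaces carry the Euclidean product norm $\|(u,v)\|=\sqrt{\|u\|^2+\|v\|^2}$, for which the dual norm of $X\times X^*$ is the Euclidean product norm on $X^*\times X^{**}$. A linear isometry is a norm-preserving linear map, not necessarily onto. *)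

(* Defs.v *)
From HB Require Import structures.
From mathcomp Require Import all_boot all_order all_algebra.
From mathcomp Require Import all_classical all_reals all_analysis.
From mathcomp Require Import ring lra.

Set Implicit Arguments.
Unset Strict Implicit.
Unset Printing Implicit Defensive.

Import Order.TTheory GRing.Theory Num.Theory.
Import numFieldNormedType.Exports.

Local Open Scope classical_set_scope.
Local Open Scope ring_scope.

Section DualSpace.
Context {R : realType} (X : normedModType R).

Definition cont_linear : {pred X -> R^o} :=
  [pred f | `[< linear f /\ continuous f >]].

Lemma cont_linear_submod_closed : submod_closed cont_linear.
Proof.
split.
  apply/asboolP; split; last by move=> x; exact: cvg_cst.
  by move=> a x y /=; rewrite scaler0 addr0.
move=> a f g /asboolP[lf cf] /asboolP[lg cg]; apply/asboolP; split.
  move=> b x y; rewrite !fctE lf lg !scalerDr !scalerA [b * a]mulrC.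
  by rewrite addrACA.
move=> x; apply: cvgD; last exact: cg.
by apply: cvgZl_tmp; exact: cf.
Qed.

HB.instance Definition _ :=
  GRing.isSubmodClosed.Build R (X -> R^o) cont_linear cont_linear_submod_closed.

Record dual := Dual {
  dual_fun :> X -> R^o ;
  dual_funP : dual_fun \in cont_linear }.

HB.instance Definition _ := [isSub for dual_fun].
HB.instance Definition _ := [Choice of dual by <:].
HB.instance Definition _ := [SubChoice_isSubLmodule of dual by <:].

Implicit Types f g : dual.

Lemma dual_linear f : linear f.
Proof. by have /asboolP[] := dual_funP f. Qed.

Lemma dual_continuous f : continuous f.
Proof. by have /asboolP[] := dual_funP f. Qed.

HB.instance Definition _ f :=
  GRing.isLinear.Build R X R^o *:%R (dual_fun f) (@dual_linear f).

Definition opnorm f : R := sup [set `|f x| | x in [set x : X | `|x| <= 1]].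

Lemma opnorm_has_ubound f :
  has_ubound [set `|f x| | x in [set x : X | `|x| <= 1]].
Proof.
have : bounded_near f (nbhs (0 : X)).
  by apply/linear_bounded_continuous; exact: dual_continuous.
move/bounded_funP => /(_ 1)[M fM].
by exists M => _ [x /fM ? <-].
Qed.

Lemma opnorm_ge0 f : 0 <= opnorm f.
Proof.
apply: ub_le_sup; first exact: opnorm_has_ubound.
by exists 0; [rewrite /= normr0 | rewrite linear0 normr0].
Qed.

Lemma le_opnorm f (x : X) : `|f x| <= opnorm f * `|x|.
Proof.
have [->|x0] := eqVneq x 0; first by rewrite linear0 !normr0 mulr0.
have nx0 : 0 < `|x| by rewrite normr_gt0.
rewrite -ler_pdivrMr//; apply: ub_le_sup; first exact: opnorm_has_ubound.
exists (`|x|^-1 *: x); first by rewrite /= normfZV.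
by rewrite linearZ normrZ ger0_norm ?invr_ge0// mulrC.
Qed.

Lemma opnorm_le f (c : R) :
  0 <= c -> (forall x, `|f x| <= c * `|x|) -> opnorm f <= c.
Proof.
move=> c0 fc; apply: ge_sup.
  by exists `|f 0|; exists 0 => //=; rewrite normr0.
move=> _ [x /= x1 <-]; apply: (le_trans (fc x)).
by rewrite -[leRHS]mulr1 ler_wpM2l.
Qed.

Lemma opnormD f g : opnorm (f + g) <= opnorm f + opnorm g.
Proof.
apply: opnorm_le => [|x]; first by rewrite addr_ge0 ?opnorm_ge0.
by rewrite mulrDl; apply: (le_trans (ler_normD _ _)); rewrite lerD ?le_opnorm.
Qed.

Lemma opnormZ (a : R) f : opnorm (a *: f) = `|a| * opnorm f.
Proof.
have le_Z b h : opnorm (b *: h) <= `|b| * opnorm h.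
  apply: opnorm_le => [|x]; first by rewrite mulr_ge0 ?opnorm_ge0.
  by rewrite [X in `|X|](_ : _ = b *: h x)// normrZ -mulrA ler_wpM2l ?le_opnorm.
apply/le_anti/andP; split; first exact: le_Z.
have [->|a0] := eqVneq a 0; first by rewrite normr0 mul0r opnorm_ge0.
rewrite -[X in _ * opnorm X](scalerK a0) -ler_pdivlMl ?normr_gt0//.
by rewrite -normfV; exact: le_Z.
Qed.

Lemma opnorm0_eq0 f : opnorm f = 0 -> f = 0.
Proof.
move=> f0; apply/val_inj/funext => x; apply/normr0_eq0/le_anti.
by rewrite normr_ge0 andbT (le_trans (le_opnorm f x))// f0 mul0r.
Qed.

HB.instance Definition _ :=
  Lmodule_isNormed.Build R dual opnormD opnormZ opnorm0_eq0.

End DualSpace.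

Section CanonicalInjection.
Context {R : realType} {X : normedModType R}.

Lemma eval_cont_linear (x : X) :
  (fun f : dual X => f x : R^o) \in @cont_linear R (dual X).
Proof.
pose e (f : dual X) : R^o := f x.
have le : linear e by [].
pose E := GRing.isLinear.Build R (dual X) R^o *:%R e le.
pose eL : {linear dual X -> R^o} := HB.pack e E.
apply/asboolP; split => //.
apply: (@bounded_linear_continuous R (dual X) R^o eL).
apply/bounded_funP => r; exists (r * `|x|) => f fr.
by apply: (le_trans (le_opnorm f x)); rewrite ler_wpM2r.
Qed.

Definition J (x : X) : dual (dual X) := Dual (eval_cont_linear x).

End CanonicalInjection.

Definition reflexive_space {R : realType} (X : normedModType R) : Prop :=
  range (@J R X) = setT.

Section CauchySchwarz.
Context {R : realType}.

Lemma sqrt_sum_ge0 (a b : R) : 0 <= a ^+ 2 + b ^+ 2.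
Proof. by rewrite addr_ge0 ?sqr_ge0. Qed.

Lemma cauchy_schwarz2 (a b c d : R) :
  a * c + b * d <= Num.sqrt (a ^+ 2 + b ^+ 2) * Num.sqrt (c ^+ 2 + d ^+ 2).
Proof.
apply: (le_trans (ler_norm _)).
rewrite -sqrtrM ?sqrt_sum_ge0// -sqrtr_sqr ler_sqrt ?mulr_ge0 ?sqrt_sum_ge0//.
by have := sqr_ge0 (a * d - b * c); nra.
Qed.

End CauchySchwarz.

Section EuclideanProduct.
Context {R : realType} (U V : normedModType R).

(* The library norm on [U * V] is the max norm; [eprod] carries the Euclidean
   one. *)
Definition eprod : Type := (U * V)%type.

HB.instance Definition _ := GRing.Lmodule.copy eprod (U * V)%type.

Definition enorm (z : eprod) : R := Num.sqrt (`|z.1| ^+ 2 + `|z.2| ^+ 2).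

Lemma enormD z w : enorm (z + w) <= enorm z + enorm w.
Proof.
rewrite /enorm; set a := `|z.1|; set b := `|z.2|; set c := `|w.1|.
set d := `|w.2|.
have [a0 b0 c0 d0] : [/\ 0 <= a, 0 <= b, 0 <= c & 0 <= d].
  by split; exact: normr_ge0.
apply: (@le_trans _ _ (Num.sqrt ((a + c) ^+ 2 + (b + d) ^+ 2))).
  rewrite ler_sqrt ?sqrt_sum_ge0// lerD// ler_sqr ?nnegrE ?addr_ge0//;
    exact: ler_normD.
rewrite -ler_sqr ?nnegrE ?addr_ge0 ?sqrtr_ge0//.
rewrite [leRHS]sqrrD !sqr_sqrtr ?sqrt_sum_ge0//.
by have := cauchy_schwarz2 a b c d; rewrite mulr2n; nra.
Qed.

Lemma enormZ (l : R) z : enorm (l *: z) = `|l| * enorm z.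
Proof.
rewrite /enorm /= !normrZ !exprMn -mulrDr sqrtrM ?sqr_ge0//.
by rewrite sqrtr_sqr normr_id.
Qed.

Lemma enorm0_eq0 z : enorm z = 0 -> z = 0.
Proof.
move/eqP; rewrite sqrtr_eq0 => z0.
have : `|z.1| ^+ 2 + `|z.2| ^+ 2 == 0.
  by rewrite eq_le z0 addr_ge0 ?sqr_ge0.
rewrite paddr_eq0 ?sqr_ge0// !sqrf_eq0 !normr_eq0 => /andP[/eqP z1 /eqP z2].
by case: z z1 z2 {z0} => /= ? ? -> ->.
Qed.

HB.instance Definition _ := Lmodule_isNormed.Build R eprod enormD enormZ enorm0_eq0.

Lemma eprod_normE (z : eprod) : `|z| = Num.sqrt (`|z.1| ^+ 2 + `|z.2| ^+ 2).
Proof. by []. Qed.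

End EuclideanProduct.

Section EuclideanDual.
Context {R : realType} {U V : normedModType R}.
Implicit Types (f : eprod (dual U) (dual V)) (z : eprod U V).

Definition eprod_pairing f z : R := f.1 z.1 + f.2 z.2.

Lemma eprod_pairing_linear f : linear (eprod_pairing f : eprod U V -> R^o).
Proof.
move=> a z w; rewrite /eprod_pairing /= !linearP/= scalerDr.
by rewrite addrACA.
Qed.

Lemma eprod_pairing_le f z : `|eprod_pairing f z| <= `|f| * `|z|.
Proof.
apply: (le_trans (ler_normD _ _)).
by apply: le_trans (cauchy_schwarz2 _ _ _ _); rewrite lerD// le_opnorm.
Qed.

Lemma eprod_pairing_norm_ge (g : dual (eprod U V)) f :
  g =1 eprod_pairing f -> `|f| <= `|g|.
Proof.
move=> gf; set N := `|g|.
have N0 : 0 <= N by exact: opnorm_ge0.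
have key x y : `|x| <= 1 -> `|y| <= 1 -> `|f.1 x| ^+ 2 + `|f.2 y| ^+ 2 <= N ^+ 2.
  move=> x1 y1; set s := _ + _.
  have s0 : 0 <= s by rewrite sqrt_sum_ge0.
  pose z : eprod U V := ((f.1 x : R) *: x, (f.2 y : R) *: y).
  have gz : g z = s.
    by rewrite gf /eprod_pairing /= !linearZ /= /s !real_normK ?num_real// !expr2.
  have zs : `|z| <= Num.sqrt s.
    rewrite /Num.norm /= /enorm /= ler_sqrt//.
    by rewrite lerD// normrZ exprMn ler_piMr ?sqr_ge0// expr_le1.
  have : s <= N * Num.sqrt s.
    have gs : `|g z| = s by rewrite gz ger0_norm.
    rewrite -[leLHS]gs; apply: (le_trans (le_opnorm g z)).
    exact: ler_wpM2l.
  rewrite -[X in X <= N ^+ 2](sqr_sqrtr s0) -[X in X <= N * _](sqr_sqrtr s0).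
  by have := sqr_ge0 (N - Num.sqrt s); nra.
rewrite -ler_sqr ?nnegrE// [X in X ^+ 2]/Num.norm /= sqr_sqrtr ?sqrt_sum_ge0//.
have le_sup (W : normedModType R) (h : dual W) c :
    (forall x, `|x| <= 1 -> `|h x| ^+ 2 <= c) -> `|h| ^+ 2 <= c.
  move=> hc; have c0 : 0 <= c.
    by apply: le_trans (sqr_ge0 _) (hc 0 _); rewrite normr0.
  rewrite -(sqr_sqrtr c0) ler_sqr ?nnegrE ?sqrtr_ge0//.
  apply: ge_sup; first by exists `|h 0|; exists 0 => //=; rewrite normr0.
  move=> _ [x /= x1 <-]; rewrite -(ger0_norm (normr_ge0 (h x))) -sqrtr_sqr.
  by rewrite ler_sqrt// hc.
rewrite -lerBrDr; apply: (le_sup _ f.1) => x x1.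
rewrite lerBrDr -lerBrDl; apply: (le_sup _ f.2) => y y1.
by rewrite lerBrDl key.
Qed.

(* [eprod_pairing] identifies [eprod (dual U) (dual V)] isometrically with
   [dual (eprod U V)]. *)
Lemma eprod_dualP :
  (forall f, exists2 g : dual (eprod U V), g =1 eprod_pairing f & `|g| = `|f|)
  /\ (forall g : dual (eprod U V), exists! f, g =1 eprod_pairing f).
Proof.
split=> [f|g].
  pose L := GRing.isLinear.Build R (eprod U V) R^o *:%R (eprod_pairing f)
    (@eprod_pairing_linear f).
  pose fL : {linear eprod U V -> R^o} := HB.pack (eprod_pairing f) L.
  have fP : (eprod_pairing f : eprod U V -> R^o) \in @cont_linear R (eprod U V).
    apply/asboolP; split; first exact: eprod_pairing_linear.
    apply: (@bounded_linear_continuous R (eprod U V) R^o fL).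
    apply/bounded_funP => r; exists (`|f| * r) => z zr.
    by apply: (le_trans (eprod_pairing_le f z)); rewrite ler_wpM2l.
  exists (Dual fP) => //; apply/le_anti/andP; split; last first.
    exact: eprod_pairing_norm_ge.
  by apply: opnorm_le => // z; exact: eprod_pairing_le.
have g1P : (fun x => g ((x, 0) : eprod U V) : R^o) \in @cont_linear R U.
  pose e x : R^o := g ((x, 0) : eprod U V).
  have le : linear e.
    move=> a x y; rewrite /e -linearP; congr (dual_fun g _).
    by rewrite /GRing.scale/= /GRing.add/= /add_pair/= scaler0 addr0.
  pose E := GRing.isLinear.Build R U R^o *:%R e le.
  pose eL : {linear U -> R^o} := HB.pack e E.
  apply/asboolP; split => //.
  apply: (@bounded_linear_continuous R U R^o eL).
  apply/bounded_funP => r; exists (`|g| * r) => x xr.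
  apply: (le_trans (le_opnorm g _)).
  apply: ler_wpM2l; first exact: opnorm_ge0.
  by rewrite eprod_normE/= normr0 expr0n/= addr0 sqrtr_sqr normr_id.
have g2P : (fun y => g ((0, y) : eprod U V) : R^o) \in @cont_linear R V.
  pose e y : R^o := g ((0, y) : eprod U V).
  have le : linear e.
    move=> a x y; rewrite /e -linearP; congr (dual_fun g _).
    by rewrite /GRing.scale/= /GRing.add/= /add_pair/= scaler0 addr0.
  pose E := GRing.isLinear.Build R V R^o *:%R e le.
  pose eL : {linear V -> R^o} := HB.pack e E.
  apply/asboolP; split => //.
  apply: (@bounded_linear_continuous R V R^o eL).
  apply/bounded_funP => r; exists (`|g| * r) => x xr.
  apply: (le_trans (le_opnorm g _)).
  apply: ler_wpM2l; first exact: opnorm_ge0.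
  by rewrite eprod_normE/= normr0 expr0n/= add0r sqrtr_sqr normr_id.
exists (Dual g1P, Dual g2P); split.
  move=> [x y]; rewrite /eprod_pairing/= -linearD; congr (dual_fun g _).
  by rewrite /GRing.add/= /add_pair/= addr0 add0r.
move=> [f1 f2] gf; congr pair; apply/val_inj/funext => x /=.
  by rewrite gf /eprod_pairing/= linear0 addr0.
by rewrite gf /eprod_pairing/= linear0 add0r.
Qed.

Definition eprodJ z : eprod (dual (dual U)) (dual (dual V)) :=
  (J z.1, J z.2).

End EuclideanDual.

Definition operator (A B : Type) := set (A * B).

Definition gra {A B : Type} (F : A -> B) : operator A B :=
  [set p | p.2 = F p.1].

Section Monotone.
Context {R : realType} {A B : zmodType} (pair : A -> B -> R).

Definition monotone (S : operator A B) : Prop :=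
  forall u v, S u -> S v -> 0 <= pair (u.1 - v.1) (u.2 - v.2).

Definition maximal_monotone (S : operator A B) : Prop :=
  monotone S /\ forall S', monotone S' -> S `<=` S' -> S' = S.

End Monotone.

Record directed := Directed {
  dir_carrier :> Type ;
  dir_le : dir_carrier -> dir_carrier -> Prop ;
  dir_refl : forall i, dir_le i i ;
  dir_trans : forall i j k, dir_le i j -> dir_le j k -> dir_le i k ;
  dir_inhabited : inhabited dir_carrier ;
  dir_ub : forall i j, exists k, dir_le i k /\ dir_le j k }.

Definition tails (D : directed) : set_system D :=
  filter_from [set: D] (fun i => [set j | dir_le i j]).
Arguments tails D : clear implicits.

(* [Zs] and [Zss] stand for the dual and the bidual of [Z], acting through
   [act] and [act'], and [inj] for the canonical injection.  The intended
   instances are [dual Z] and [dual (dual Z)] with evaluation and [J], and, for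
   [Z := eprod U V], the spaces [eprod (dual U) (dual V)] and
   [eprod (dual (dual U)) (dual (dual V))] with [eprod_pairing] and [eprodJ];
   see [eprod_dualP]. *)
Section TypeD.
Context {R : realType} {Z Zs Zss : normedModType R}.
Variables (act : Zs -> Z -> R) (act' : Zss -> Zs -> R) (inj : Z -> Zss).

(* The coarsest topology on [Zss] making [act' ^~ zs] continuous for all [zs]. *)
Definition weak_star : Type :=
  initial_topology (act' : Zss -> {ptws Zs -> R^o}).
HB.instance Definition _ := Topological.on weak_star.

Definition bounded_net_closure (S : operator Z Zs) : operator Zss Zs :=
  [set w | exists (D : directed) (u : D -> Z * Zs),
     [/\ forall i, S (u i),
         exists M : R, forall i, `|(u i).1| <= M /\ `|(u i).2| <= M &
         (fun i => (inj (u i).1, (u i).2) : weak_star * Zs) @ tails D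
           --> (w : weak_star * Zs)]].

Definition type_D (S : operator Z Zs) : Prop :=
  maximal_monotone (fun z zs => act zs z) S /\
  forall w : Zss * Zs,
    (forall y, S y -> 0 <= act' (w.1 - inj y.1) (w.2 - y.2)) ->
    bounded_net_closure S w.

End TypeD.

(* Main.v *)
From HB Require Import structures.
Require Import Defs.
From mathcomp Require Import all_boot all_order all_algebra.
From mathcomp Require Import all_classical all_reals all_analysis.
From mathcomp Require Import ring lra.

(** The operator [T] is skew: [<T z, z> = - z.2 z.1 + z.1 z.2 = 0].  Hence the
    pairing of [w - t z] with [ws - t T z] is affine in the scalar [t], and it
    can only stay nonnegative for all [t] if its slope vanishes.  Applied in the
    bidual ([skew_related]), this says that the pairs [((a, A), (f, b))]
    monotonically related to the graph of [T] have [b = a] and [f] equal to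
    minus [A] composed with [J].  Inside [X * dual X] the only such pairs are
    the points of the graph, so [T] is maximal monotone.

    Failure of type (D).  For every [a] in the bidual of [X], the pair
    [((a, 0), (0, a))] is monotonically related to the graph.  A net of the graph
    converging to it has second components [(- x', J x)] converging in norm to
    [(0, a)]; as [J] is an isometry and [X] is complete, its range is closed
    ([J_range_closed]), and so contains [a].  Non-reflexivity provides an [a]
    outside that range.

    Infinitely many extensions.  On pairs related to the graph of [T], the
    pairing is [q (a, A) = (P A) a], where [P A] is [A] minus the [J]-image of
    [A] composed with [J], a functional vanishing on [J X].  Monotone extensions
    of [T] thus amount to monotone operators from the quotient of the bidual by
    [J X], which is nonzero, to its dual, containing the origin.  With a nonzero
    functional [A0] vanishing on [J X] ([J_annihilator]), the rank one operators
    [a |-> l * A0 a *: A0], [l >= 0], are monotone, everywhere defined and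
    linear, hence maximal ([rank_one_maximal_monotone]), and distinct for
    distinct [l].

    That [J] is isometric and that [A0] exists both come from the Hahn-Banach
    theorem, in the form of a linear functional below a sublinear [p] that agrees
    with [p] at a given point ([support_functional]): [p] is the norm in the
    first case, the distance to [J X] in the second. *)

Set Implicit Arguments.
Unset Strict Implicit.
Unset Printing Implicit Defensive.

Import Order.TTheory GRing.Theory Num.Theory.
Import numFieldNormedType.Exports.

Local Open Scope classical_set_scope.
Local Open Scope ring_scope.

(** * Sublinear functionals and supporting linear functionals *)

Section Sublinear.
Context {R : realType} {V : lmodType R}.
Implicit Types (p q : V -> R) (x y a : V).

(** Homogeneity is encoded as one inequality for [0 < c], the form that passes
    most directly to infima; equality and the value [0] at [0] follow. *)
Definition sublinear q : Prop :=
  (forall x y, q (x + y) <= q x + q y) /\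
  (forall (c : R) x, 0 < c -> q (c *: x) <= c * q x).

Lemma sublinearZ q (c : R) x : sublinear q -> 0 < c -> q (c *: x) = c * q x.
Proof.
move=> [_ qZ] c0; apply/le_anti; rewrite qZ//=.
rewrite -ler_pdivlMl// -[X in q X <= _](scalerK (lt0r_neq0 c0)).
by apply: qZ; rewrite invr_gt0.
Qed.

Lemma sublinear0 q : sublinear q -> q 0 = 0.
Proof.
move=> sq; have /eqP := @sublinearZ q 2 0 sq (ltr0Sn R 1).
by rewrite scaler0 => /eqP h; lra.
Qed.

Lemma sublinear_ge q x : sublinear q -> - q (- x) <= q x.
Proof.
move=> sq; have := sq.1 x (- x); rewrite subrr sublinear0// => h; lra.
Qed.

(** The members of the family may fail to be sublinear: it is enough that each
    inequality holds up to passing to a lower member.  Decreasing chains of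
    sublinear functionals, the directional infima of [sublinear_directional] and
    the distance to a subspace are all of this kind. *)
Lemma sublinear_inf (I : Type) (D : set I) (A : I -> V -> R) :
  D !=set0 ->
  (forall x, exists m, forall i, D i -> m <= A i x) ->
  (forall i j x y, D i -> D j ->
    exists2 k, D k & A k (x + y) <= A i x + A j y) ->
  (forall i (c : R) x, D i -> 0 < c ->
    exists2 k, D k & A k (c *: x) <= c * A i x) ->
  sublinear (fun x => inf [set A i x | i in D]) /\
  forall i x, D i -> inf [set A i x | i in D] <= A i x.
Proof.
move=> [i0 Di0] bnd AD AZ.
have infle i x : D i -> inf [set A i x | i in D] <= A i x.
  move=> Di; apply: ge_inf; last by exists i.
  by have [m mA] := bnd x; exists m => _ [j Dj <-]; exact: mA.
have leinf (m : R) x : (forall i, D i -> m <= A i x) ->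
    m <= inf [set A i x | i in D].
  move=> mA; apply: lb_le_inf; first by exists (A i0 x), i0.
  by move=> _ [j Dj <-]; exact: mA.
split=> //; split=> [x y|c x c0].
  rewrite -lerBlDr; apply: (leinf) => i Di; rewrite lerBlDr -lerBlDl.
  apply: (leinf) => j Dj; rewrite lerBlDl.
  by have [k Dk] := AD i j x y Di Dj; apply: le_trans; exact: infle.
rewrite -ler_pdivrMl//; apply: (leinf) => i Di; rewrite ler_pdivrMl//.
by have [k Dk] := AZ i c x Di c0; apply: le_trans; exact: infle.
Qed.

(** Replacing [q] by its lower directional regularization along [a] keeps it
    sublinear and brings its value at [- a] down to [- q a], the least that
    subadditivity permits when the value at [a] is [q a]. *)
Lemma sublinear_directional q a : sublinear q ->
  exists q', [/\ sublinear q', forall x, q' x <= q x &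
    forall x, q' x <= q (x + a) - q a].
Proof.
move=> sq.
pose A (t : R) x := q (x + t *: a) - t * q a.
have qt t : 0 <= t -> q (t *: a) = t * q a.
  rewrite le_eqVlt => /predU1P[<-|t0]; last exact: sublinearZ.
  by rewrite scale0r mul0r sublinear0.
have [||||sA infle] := @sublinear_inf R [set t | 0 <= t] A.
- by exists 0; rewrite /= lexx.
- move=> x; exists (- q (- x)) => t /= t0; rewrite /A -qt//.
  have := sq.1 (x + t *: a) (- x); rewrite addrAC subrr add0r => h; lra.
- move=> s t x y /= s0 t0; exists (s + t); first exact: addr_ge0.
  have := sq.1 (x + s *: a) (y + t *: a).
  by rewrite /A scalerDl addrACA mulrDl => h; lra.
- move=> t c x /= t0 c0; exists (c * t); first by rewrite mulr_ge0// ltW.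
  by rewrite /A -scalerA -scalerDr sublinearZ// mulrBr mulrA.
exists (fun x => inf [set A t x | t in [set t | 0 <= t]]); split => //= x.
- have := infle 0 x; rewrite /A scale0r mul0r addr0 subr0; apply.
  by rewrite /= lexx.
- by have := infle 1 x; rewrite /A scale1r mul1r; apply; rewrite /= ler01.
Qed.

(** A minimal sublinear functional is additive, since regularizing along any
    direction cannot lower it; minimal ones exist by Zorn's lemma. *)
Lemma sublinear_dominates_linear p : sublinear p ->
  exists2 f : V -> R, linear (f : V -> R^o) & forall x, f x <= p x.
Proof.
move=> sp.
pose good (q : V -> R) := sublinear q /\ forall x, q x <= p x.
pose T := {q : V -> R | good q}.
pose below (s t : T) := `[< forall x, sval t x <= sval s x >].
have p0 : good p by [].
have [t|r s t /asboolP rs /asboolP st|C Ctot|[q [sq qp]] qmin] :=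
  @ZL_preorder T (@exist _ good p p0) below.
- exact/asboolP.
- by apply/asboolP => x; exact: le_trans (rs x).
- have [[s0 Cs0]|C0] := pselect (C !=set0); last first.
    by exists (@exist _ good p p0) => s Cs; case: C0; exists s.
  have [||||sI infle] := @sublinear_inf T C (fun s => sval s).
  + by exists s0.
  + move=> x; exists (- p (- x)) => -[s [ss sle]] _ /=.
    by apply: le_trans (sublinear_ge x ss); rewrite lerN2.
  + move=> s t x y Cs Ct; have [/asboolP st|/asboolP ts] := Ctot _ _ Cs Ct.
      exists t => //; have := (svalP t).1.1 x y; have := st x; lra.
    exists s => //; have := (svalP s).1.1 x y; have := ts y; lra.
  + by move=> s c x Cs c0; exists s => //; exact: (svalP s).1.2.
  have Ile : good (fun x => inf [set sval s x | s in C]).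
    by split=> // x; apply: le_trans (infle s0 x Cs0) ((svalP s0).2 x).
  by exists (@exist _ good _ Ile) => s Cs; apply/asboolP => x /=; exact: infle.
exists q => //.
have qD x a : q (x + a) = q x + q a.
  apply/le_anti; rewrite sq.1/=.
  have [q' [sq' q'q q'a]] := sublinear_directional a sq.
  have q'p : good q'.
    by split=> // z; exact: le_trans (qp z).
  have /qmin/asboolP/(_ x)/= :
      below (@exist _ good q (conj sq qp)) (@exist _ good q' q'p).
    exact/asboolP.
  have := q'a x; lra.
have qN x : q (- x) = - q x.
  by have := qD x (- x); rewrite subrr sublinear0// => h; lra.
move=> c x y; rewrite qD; congr (_ + _).
have [c0|c0|<-] := ltgtP 0 c.
- exact: sublinearZ.
- by rewrite -[c]opprK scaleNr qN sublinearZ ?oppr_gt0// scaleNr.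
- by rewrite !scale0r sublinear0.
Qed.

(** The analytic Hahn-Banach theorem in supporting form: apply the domination
    lemma to the regularization of [p] along [a]. *)
Lemma support_functional p a : sublinear p ->
  exists f : V -> R,
    [/\ linear (f : V -> R^o), forall x, f x <= p x & f a = p a].
Proof.
move=> sp; have [q [sq qp qa]] := sublinear_directional a sp.
have [f lf fq] := sublinear_dominates_linear sq.
have fp x : f x <= p x by apply: le_trans (qp x).
exists f; split => //; apply/le_anti; rewrite fp/=.
pose L := GRing.isLinear.Build R V R^o *:%R (f : V -> R^o) lf.
pose fL : {linear V -> R^o} := HB.pack (f : V -> R^o) L.
have fN : f (- a) = - f a := linearN fL a.
have := qa (- a); rewrite addNr sublinear0// sub0r.
have := fq (- a); rewrite fN; lra.
Qed.

End Sublinear.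

(** * Duality *)

Section Dual.
Context {R : realType}.

Lemma dualDE (Y : normedModType R) (f g : dual Y) y : (f + g) y = f y + g y.
Proof. by []. Qed.

Lemma dualNE (Y : normedModType R) (f : dual Y) y : (- f) y = - f y.
Proof. by []. Qed.

Lemma dualZE (Y : normedModType R) (c : R) (f : dual Y) y :
  (c *: f) y = c * f y.
Proof. by []. Qed.

Lemma dual_argD (Y : normedModType R) (f : dual Y) y z : f (y + z) = f y + f z.
Proof. exact: linearD. Qed.

Lemma dual_argN (Y : normedModType R) (f : dual Y) y : f (- y) = - f y.
Proof. exact: linearN. Qed.

Lemma dual_argZ (Y : normedModType R) (c : R) (f : dual Y) y :
  f (c *: y) = c * f y.
Proof. exact: linearZ. Qed.

Lemma dual_arg0 (Y : normedModType R) (f : dual Y) : f 0 = 0.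
Proof. exact: linear0. Qed.

Lemma dual_ext (Y : normedModType R) (f g : dual Y) : f =1 g -> f = g.
Proof. by move=> fg; apply/val_inj/funext. Qed.

Lemma dual_of_le_norm (Y : normedModType R) (f : Y -> R) :
  linear (f : Y -> R^o) -> (forall y, f y <= `|y|) ->
  exists2 g : dual Y, g =1 f & `|g| <= 1.
Proof.
move=> lf fle.
pose L := GRing.isLinear.Build R Y R^o *:%R (f : Y -> R^o) lf.
pose fL : {linear Y -> R^o} := HB.pack (f : Y -> R^o) L.
have fN y : f (- y) = - f y := linearN fL y.
have fnorm y : `|f y| <= `|y|.
  by rewrite ler_norml fle andbT -[f y]opprK -fN lerN2 -normrN fle.
have fP : (f : Y -> R^o) \in @cont_linear R Y.
  apply/asboolP; split => //.
  apply: (@bounded_linear_continuous R Y R^o fL).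
  by apply/bounded_funP => r; exists r => y; apply: le_trans (fnorm y).
exists (Dual fP) => //; apply: opnorm_le => // y.
by rewrite mul1r; exact: fnorm.
Qed.

Lemma JE (X : normedModType R) (x : X) (f : dual X) : J x f = f x.
Proof. by []. Qed.

Lemma J_linear (X : normedModType R) : linear (@J R X).
Proof. by move=> c x y; apply: dual_ext => f /=; exact: linearP. Qed.

HB.instance Definition _ (X : normedModType R) :=
  GRing.isLinear.Build R X (dual (dual X)) *:%R (@J R X) (@J_linear X).

(** A functional supporting the norm at [x] shows that [J] does not shrink [x]. *)
Lemma J_norm (X : normedModType R) (x : X) : `|J x| = `|x|.
Proof.
apply/le_anti/andP; split.
  by apply: opnorm_le => // f; rewrite mulrC; exact: (le_opnorm f x).
have sN : sublinear (fun y : X => `|y|).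
  by split=> [y z|c y c0]; [exact: ler_normD|rewrite normrZ gtr0_norm].
have [f [lf fle fx]] := support_functional x sN.
have [g gf g1] := dual_of_le_norm lf fle.
rewrite -fx -gf; apply: le_trans (ler_norm _) _.
apply: (le_trans (le_opnorm (J x) g)).
by rewrite -[leRHS]mulr1; apply: ler_wpM2l => //; exact: opnorm_ge0.
Qed.

(** An isometric image of a complete space is closed. *)
Lemma J_range_closed (X : completeNormedModType R) (a : dual (dual X)) :
  (forall e : R, 0 < e -> exists x, `|a - J x| < e) -> range (@J R X) a.
Proof.
move=> aJ.
pose B (e : R) := [set x : X | `|a - J x| < e].
pose F := filter_from [set e : R | 0 < e] B.
have FF : ProperFilter F.
  apply: filter_from_proper; last by move=> e /aJ[x ax]; exists x.
  apply: filter_from_filter; first by exists 1; rewrite /= ltr01.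
  move=> e e' /= e0 e'0; exists (Num.min e e'); first by rewrite lt_min e0.
  by move=> x; rewrite /B/= lt_min => /andP[].
have Fc : cauchy F.
  apply/cauchy_exP => e e0; have e20 : 0 < e / 2 by rewrite divr_gt0.
  have [x ax] := aJ _ e20; exists x; exists (e / 2) => // y ay.
  rewrite -ball_normE /= -J_norm linearB /=.
  have -> : J x - J y = (a - J y) - (a - J x).
    by rewrite opprB [RHS]addrC subrKA.
  by apply: le_lt_trans (ler_normB _ _) _; rewrite [e]splitr ltrD.
have /cauchy_cvg/cvg_ex[l Fl] := Fc.
exists l => //; apply/esym/eqP; rewrite -subr_eq0 -normr_le0.
apply/ler_addgt0Pl => e e0; rewrite addr0.
have e20 : 0 < e / 2 by rewrite divr_gt0.
have F1 : F (B (e / 2)) by exists (e / 2).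
have /fcvgrPdist_lt/(_ _ e20) F2 := Fl.
have [x [ax lx]] := filter_ex (filterI F1 F2).
have -> : a - J l = (a - J x) - J (l - x).
  by rewrite linearB /= opprB addrA subrK.
apply: le_trans (ler_normB _ _) _.
by rewrite J_norm [e]splitr lerD// ltW.
Qed.

(** The gauge is the distance to the range of [J]: a linear functional below it
    is bounded by the norm and vanishes on that range, while the value at a
    point outside the closed range is a positive distance. *)
Lemma J_annihilator (X : completeNormedModType R) (a : dual (dual X)) :
  ~ range (@J R X) a ->
  exists A : dual (dual (dual X)), (forall x, A (J x) = 0) /\ A a != 0.
Proof.
move=> aJ.
have [||||sd dle] := @sublinear_inf R (dual (dual X)) X setT
  (fun x b => `|b - J x|).
- by exists 0.
- by move=> b; exists 0 => x _; exact: normr_ge0.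
- move=> x y b c _ _; exists (x + y) => //.
  by rewrite linearD opprD addrACA ler_normD.
- move=> x c b _ c0; exists (c *: x) => //.
  by rewrite linearZ -scalerBr normrZ gtr0_norm.
set d := fun b => _ in sd.
have dle' b x : d b <= `|b - J x| by exact: dle.
have [f [lf fd fa]] := support_functional a sd.
have fle b : f b <= `|b|.
  by apply: le_trans (fd b) _; have := dle' b 0; rewrite linear0 subr0.
have [A Af _] := dual_of_le_norm lf fle.
exists A; split.
  have Ale x : A (J x) <= 0.
    rewrite Af; apply: le_trans (fd _) _.
    by have := dle' (J x) x; rewrite subrr normr0.
  move=> x; apply/le_anti; rewrite Ale/=.
  by have := Ale (- x); rewrite linearN/= linearN/= oppr_le0.
rewrite Af fa; apply/eqP => da; apply: aJ; apply: J_range_closed => e e0.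
have hinf : has_inf [set `|a - J x| | x in [set: X]].
  split; first by exists `|a - J 0|, 0.
  by exists 0 => _ [x _ <-].
have [_ [x _ <-]] := inf_adherent e0 hinf.
by rewrite -/(d a) da add0r; exists x.
Qed.

End Dual.

(** * The skew isometry and its monotone extensions *)

Lemma nonreflexive_out (R : realType) (X : normedModType R) :
  ~ reflexive_space X -> exists a, ~ range (@J R X) a.
Proof.
by move=> nrefl; apply/existsNP => h; apply: nrefl; apply/seteqP; split.
Qed.

Lemma eprod_pairingB (R : realType) (U V : normedModType R)
    (f g : eprod (dual U) (dual V)) (z w : eprod U V) :
  eprod_pairing (f - g) (z - w) =
  (f.1 - g.1) (z.1 - w.1) + (f.2 - g.2) (z.2 - w.2).
Proof. by []. Qed.

Section SkewIsometry.
Context {R : realType} {X : completeNormedModType R}.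

Let Z := eprod X (dual X).
Let Zs := eprod (dual X) (dual (dual X)).
Let Zss := eprod (dual (dual X)) (dual (dual (dual X))).

Definition skew (z : Z) : Zs := (- z.2, J z.1).

Lemma skew_linear : linear skew.
Proof.
move=> c z w; apply: (congr2 (@Datatypes.pair _ _)); last exact: linearP.
by change (- (c *: z.2 + w.2) = c *: - z.2 - w.2); rewrite scalerN -opprD.
Qed.

Lemma skew_norm z : `|skew z| = `|z|.
Proof. by rewrite !eprod_normE /= normrN J_norm addrC. Qed.

(** The diagonal term of the expansion is absent because [skew] is skew; what
    remains is affine in [z]. *)
Lemma skew_relatedE (w : Zss) (ws : Zs) z :
  eprod_pairing (w - eprodJ z) (ws - skew z) =
  eprod_pairing w ws - ((ws.1 z.1 + w.2 (J z.1)) + (ws.2 z.2 - w.1 z.2)).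
Proof.
change ((w.1 - J z.1) (ws.1 - (- z.2)) + (w.2 - J z.2) (ws.2 - J z.1) =
  w.1 ws.1 + w.2 ws.2 - ((ws.1 z.1 + w.2 (J z.1)) + (ws.2 z.2 - w.1 z.2))).
rewrite opprK !dualDE !dualNE !dual_argD !dual_argN !JE.
ring.
Qed.

Lemma affine_ge0 (c s : R) : (forall t, 0 <= c - t * s) -> s = 0.
Proof.
move=> h; apply/eqP; apply: contraT => s0.
(* at this [t] the affine expression takes the value [-1] *)
by have := h ((c + 1) / s); rewrite divfK//; lra.
Qed.

Lemma quadratic_ge0 (c k : R) : (forall t, 0 <= t * c + t ^+ 2 * k) -> c = 0.
Proof.
move=> h; apply/eqP; apply: contraT => c0.
(* as [m > k], the linear term wins at [t = - c / m] *)
pose m := 1 + `|k|.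
have m0 : 0 < m by rewrite /m; have := normr_ge0 k; lra.
have := h (- c / m).
have -> : - c / m * c + (- c / m) ^+ 2 * k = (c / m) ^+ 2 * (k - m).
  by field; rewrite lt0r_neq0.
have c2 : 0 < (c / m) ^+ 2.
  by rewrite exprn_even_gt0//= mulf_neq0// invr_eq0 lt0r_neq0.
rewrite pmulr_rge0// /m; have := ler_norm k; lra.
Qed.

(** Along the line [t *: z] the pairing is affine in [t], so nonnegativity for
    all [t] forces its slope to vanish; the choices [(0, f)] and [(x, 0)] of [z]
    separate the two summands of the slope. *)
Lemma skew_related (w : Zss) (ws : Zs) :
  (forall z, 0 <= eprod_pairing (w - eprodJ z) (ws - skew z)) ->
  ws.2 = w.1 /\ forall x, ws.1 x = - w.2 (J x).
Proof.
move=> h.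
have h0 z : (ws.1 z.1 + w.2 (J z.1)) + (ws.2 z.2 - w.1 z.2) = 0.
  apply: (@affine_ge0 (eprod_pairing w ws)) => t.
  have := h (t *: z); rewrite skew_relatedE /= !linearZ /=.
  rewrite /GRing.scale/=.
  set l := (X in 0 <= X -> _); set r := (X in _ -> 0 <= X).
  by suff -> : l = r by []; rewrite /l /r; ring.
have J0 : J (0 : X) = 0 by exact: linear0.
split.
  apply: dual_ext => f; have /= := h0 (0, f).
  by rewrite J0 !dual_arg0 addr0 add0r => /subr0_eq.
move=> x; have /= := h0 (x, 0).
by rewrite !dual_arg0 subr0 addr0 => /eqP; rewrite addr_eq0 => /eqP.
Qed.

(** A point of the space related to the graph is related to it in the bidual. *)
Lemma skew_maximal_monotone :
  maximal_monotone (fun (z : Z) (zs : Zs) => eprod_pairing zs z) (gra skew).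
Proof.
have pJ (z : Z) (zs : Zs) :
    eprod_pairing zs z = eprod_pairing (eprodJ z : Zss) zs.
  by [].
have JB (z w : Z) : eprodJ (z - w) = eprodJ z - eprodJ w :> Zss.
  by rewrite /eprodJ /= !linearB.
split.
  move=> [z zs] [w ws]; rewrite /gra /= => -> ->.
  rewrite pJ JB skew_relatedE.
  change (0 <= (- z.2) z.1 + z.2 z.1 -
    (((- z.2) w.1 + z.2 w.1) + (w.2 z.1 - w.2 z.1))).
  by rewrite !dualNE; lra.
move=> S' mS' TS'; apply/seteqP; split => // -[w ws] S'w; rewrite /gra /=.
have [|ws2 ws1] := @skew_related (eprodJ w) ws.
  move=> z.
  have : 0 <= eprod_pairing (ws - skew z) (w - z).
    exact: (mS' (w, ws) (z, skew z) S'w (TS' (z, skew z) erefl)).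
  by rewrite pJ JB.
move: ws1 ws2; case: ws {S'w} => f g /= fw ->.
apply: (congr2 (@Datatypes.pair _ _)) => //.
by apply: dual_ext => x; rewrite fw.
Qed.

(** The pair [((a, 0), (0, a))] is related to the graph; norm convergence of the
    second components puts [a] in the closed range of [J]. *)
Lemma skew_not_type_D : ~ reflexive_space X ->
  ~ @type_D R Z Zs Zss eprod_pairing eprod_pairing eprodJ (gra skew).
Proof.
move=> nrefl [_ typeD].
have [a aJ] := nonreflexive_out nrefl.
have [|D [u [uT _ ucv]]] := typeD ((a, 0), (0, a)).
  move=> [z zs]; rewrite /gra /= => ->.
  rewrite skew_relatedE.
  change (0 <= a 0 + 0 - ((0 + 0) + (a z.2 - a z.2)) :> R).
  by rewrite dual_arg0; lra.
apply: aJ; apply: J_range_closed => e e0.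
have tF : ProperFilter (tails D).
  apply: filter_from_proper; last by move=> i _; exists i; exact: dir_refl.
  apply: filter_from_filter; first by have [i] := dir_inhabited D; exists i.
  move=> i j _ _; have [k [ik jk]] := dir_ub i j; exists k => // l kl.
  by split; [exact: dir_trans kl|exact: dir_trans kl].
have cv2 : (u i).2 @[i --> tails D] --> ((0, a) : Zs).
  have sndcv := @cvg_comp _ _ _ _ snd _ _ _ ucv.
  exact: sndcv _ (@cvg_snd _ _ (nbhs _) (nbhs _) _).
have /cvgrPdist_lt/(_ _ e0)/filter_ex[i ui] := cv2.
exists (u i).1.1; apply: le_lt_trans ui.
have -> : (u i).2 = skew (u i).1 := uT i.
rewrite eprod_normE /= -{1}[X in X <= _](ger0_norm (normr_ge0 _)) -sqrtr_sqr.
by rewrite ler_sqrt ?sqrt_sum_ge0// lerDr sqr_ge0.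
Qed.

(** The first two conditions hold for every pair monotonically related to
    [gra skew].  They turn the left side of the third into the value at [b] of
    [u.1.2] minus the [J]-image of [u.1.2] composed with [J]: this is the part of
    [u.1.2] that vanishes on the range of [J], and it is prescribed to be the
    positive rank one image of [u.1.1]. *)
Definition rank_one_extension (A0 : dual (dual (dual X))) (l : R) :
    operator Zss Zs :=
  [set u : Zss * Zs | [/\ u.2.2 = u.1.1, forall x, u.2.1 x = - u.1.2 (J x) &
    forall b, u.1.2 b + b u.2.1 = l * A0 u.1.1 * A0 b]].

Section RankOne.
Variables (A0 : dual (dual (dual X))) (A0J : forall x, A0 (J x) = 0).

Lemma rank_one_extends l z : rank_one_extension A0 l (eprodJ z, skew z).
Proof.
split=> // b.
change (b z.2 + b (- z.2) = l * A0 (J z.1) * A0 b).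
by rewrite A0J dual_argN subrr mulr0 mul0r.
Qed.

(** As [A0] vanishes on the range of [J], the functional [(l * A0 a) *: A0] is its
    own annihilating part: the extension has a point above every [a]. *)
Lemma rank_one_witness l a :
  rank_one_extension A0 l ((a, (l * A0 a) *: A0), (0, a)).
Proof.
split=> // [x|b].
  change (0 = - ((l * A0 a) *: A0) (J x)).
  by rewrite dualZE A0J mulr0 oppr0.
change (((l * A0 a) *: A0) b + b 0 = l * A0 a * A0 b).
by rewrite dual_arg0 addr0.
Qed.

(** The pairing of the differences of two of its points, above [a] and [b], is
    [l * A0 (a - b) ^+ 2], whence monotonicity.  Since the operator is
    everywhere defined and linear, maximality follows by testing a related pair
    against the point of the graph above [w.1 - t *: b] for all [t]: the
    nonnegative quantity is quadratic in [t] without constant term. *)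
Lemma rank_one_maximal_monotone l : 0 <= l ->
  maximal_monotone eprod_pairing (rank_one_extension A0 l).
Proof.
move=> l0; split.
  move=> [[a A] [f a']] [[b B] [g b']] [/= -> fA uA] [/= -> gB vB].
  have -> : eprod_pairing ((a, A) - (b, B) : Zss) ((f, a) - (g, b) : Zs) =
      l * A0 (a - b) ^+ 2.
    change ((a - b) (f - g) + (A - B) (a - b) = l * A0 (a - b) ^+ 2).
    have := uA (a - b); have := vB (a - b).
    rewrite !(dualDE, dualNE, dual_argD, dual_argN) => vBab uAab.
    lra.
  by rewrite mulr_ge0// sqr_ge0.
move=> S' mS' BS'; apply/seteqP; split => // -[w ws] S'w.
have rel v : rank_one_extension A0 l v ->
    0 <= eprod_pairing (w - v.1) (ws - v.2).
  by move=> /BS'; exact: (mS' (w, ws)).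
have [ws2 ws1] : ws.2 = w.1 /\ forall x, ws.1 x = - w.2 (J x).
  by apply: skew_related => z; exact: (rel (_, _) (rank_one_extends l z)).
split=> //= b; apply/eqP; rewrite -subr_eq0; apply/eqP.
apply: (@quadratic_ge0 _ (l * A0 b ^+ 2)) => t.
have := rel _ (rank_one_witness l (w.1 - t *: b)).
have -> : eprod_pairing (w - (w.1 - t *: b, (l * A0 (w.1 - t *: b)) *: A0))
    (ws - (0, w.1 - t *: b)) =
  (w.1 - (w.1 - t *: b)) (ws.1 - 0) +
  (w.2 - (l * A0 (w.1 - t *: b)) *: A0) (w.1 - (w.1 - t *: b)).
  by rewrite eprod_pairingB ws2.
rewrite subr0 subKr.
rewrite !(dualDE, dualNE, dualZE, dual_argD, dual_argN, dual_argZ).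
set x := (X in 0 <= X -> _); set y := (X in _ -> 0 <= X).
by suff -> : x = y by []; rewrite /x /y; ring.
Qed.

Lemma rank_one_inj a : A0 a != 0 ->
  injective (fun n : nat => rank_one_extension A0 n%:R).
Proof.
move=> A0a m n mn.
have := rank_one_witness m%:R a; rewrite mn => -[_ _ /(_ a)].
change (((m%:R * A0 a) *: A0) a + a 0 = n%:R * A0 a * A0 a -> m = n).
rewrite dual_arg0 addr0 dualZE => /(mulIf A0a)/(mulIf A0a)/eqP.
by rewrite eqr_nat => /eqP.
Qed.

End RankOne.
End SkewIsometry.

Theorem theorem3p1 (R : realType) (X : completeNormedModType R)
    (hX : ~ reflexive_space X) :
  let T : eprod X (dual X) -> eprod (dual X) (dual (dual X)) :=
    fun z => (- z.2, J z.1) in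
  [/\ linear T,
      forall z, `|T z| = `|z|,
      maximal_monotone (fun z zs => eprod_pairing zs z) (gra T),
      ~ type_D eprod_pairing eprod_pairing eprodJ (gra T) &
      infinite_set
        [set B : operator (eprod (dual (dual X)) (dual (dual (dual X))))
                          (eprod (dual X) (dual (dual X))) |
          maximal_monotone eprod_pairing B /\
          forall z, B (eprodJ z, T z)]].
Proof.
split.
- exact: skew_linear.
- exact: skew_norm.
- exact: skew_maximal_monotone.
- exact: skew_not_type_D.
have [a /J_annihilator[A0 [A0J A0a]]] := nonreflexive_out hX.
move=> fin; apply: infinite_nat.
apply: sub_finite_set (finite_preimage _ fin); last first.
  by move=> m n _ _; exact: (rank_one_inj A0J A0a).
move=> n _; split; first exact: rank_one_maximal_monotone.
by move=> z; exact: rank_one_extends.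
Qed.
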